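(* Let $N=\{1,\dots,n\}$ ($n\ge1$) be a set of agents and $M$ a set of $m$ indivisible goods with $m<2n$. Suppose every agent $i\in N$ has a normalized, monotone, leveled valuation $v_i:2^M\to\mathbb{R}_{\ge0}$. Then there exists a complete allocation $A=(A_1,\dots,A_n)\in\Pi_n(M)$ with $v_i(A_i)\ge \mu_i^n(M)$ for every $i\in N$ (an exact MMS allocation).
   Context: A valuation $v:2^M\to\mathbb{R}_{\ge0}$ is normalized if $v(\emptyset)=0$, monotone if $v(S)\le v(T)$ whenever $S\subseteq T$, and leveled if $v(S)>v(T)$ for all $S,T\subseteq M$ with $|S|>|T|$. $\Pi_n(M)$ is the set of all tuples $(A_1,\dots,A_n)$ of pairwise disjoint (possibly empty) subsets of $M$ whose union is $M$. The maximin share of agent $i$ is $\mu_i^n(M)=\max_{A\in\Pi_n(M)}\min_{k\in\{1,\dots,n\}} v_i(A_k)$. *)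

(* Defs.v *)
From mathcomp Require Import all_boot all_order all_algebra.
From mathcomp Require Import reals.
Set Implicit Arguments.
Unset Strict Implicit.
Unset Printing Implicit Defensive.
Import Order.TTheory GRing.Theory Num.Theory.
Local Open Scope ring_scope.

Section Valuations.
Variables (R : realType) (M : finType).
Implicit Types (v : {set M} -> R) (S T : {set M}).

Definition nonnegative v : Prop := forall S, 0 <= v S.

Definition normalized v : Prop := v set0 = 0.

Definition monotone v : Prop := forall S T, S \subset T -> v S <= v T.

Definition leveled v : Prop := forall S T, (#|T| < #|S|)%N -> v T < v S.

End Valuations.

Definition allocations (n : nat) (M : finType) : {set {ffun 'I_n -> {set M}}} :=
  [set A : {ffun 'I_n -> {set M}} |
    [forall i, forall j, (i != j) ==> [disjoint A i & A j]]
    && (\bigcup_i A i == [set: M])].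

Section MaximinShare.
Variables (R : realType) (M : finType) (n : nat) (n_gt0 : (0 < n)%N).
Implicit Types (v : {set M} -> R) (A : {ffun 'I_n -> {set M}}).

(* The default values of the two iterated operators below are themselves
   members of the ranges, so they do not affect the minimum and the maximum;
   see [min_bundleP] and [mmsP]. *)
Definition min_bundle v A : R :=
  \big[Num.min/v (A (Ordinal n_gt0))]_(k < n) v (A k).

Definition grand_allocation : {ffun 'I_n -> {set M}} :=
  [ffun k => if k == Ordinal n_gt0 then [set: M] else set0].

Definition mms v : R :=
  \big[Num.max/min_bundle v grand_allocation]_(A in allocations n M)
    min_bundle v A.

Lemma grand_allocationP : grand_allocation \in allocations n M.
Proof.
rewrite inE; apply/andP; split.
  apply/forallP => i; apply/forallP => j; apply/implyP => neq_ij.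
  rewrite !ffunE; case: eqP => [ei|_]; last by rewrite -setI_eq0 set0I.
  case: eqP => [ej|_]; last by rewrite -setI_eq0 setI0.
  by rewrite ei ej eqxx in neq_ij.
rewrite eqEsubset subsetT /=; apply/subsetP => x _.
by apply/bigcupP; exists (Ordinal n_gt0); rewrite // ffunE eqxx.
Qed.

Lemma min_bundleP v A :
  (exists k, min_bundle v A = v (A k)) /\ (forall k, min_bundle v A <= v (A k)).
Proof.
split; last by move=> k; apply: bigmin_le.
rewrite /min_bundle; elim/big_ind: _ => [|x y [i ->] [j ->]|k _].
- by exists (Ordinal n_gt0).
- by rewrite /Num.min; case: ifP => _; [exists i | exists j].
- by exists k.
Qed.

Lemma mmsP v :
  (exists2 A, A \in allocations n M & mms v = min_bundle v A) /\
  (forall A, A \in allocations n M -> min_bundle v A <= mms v).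
Proof.
split; last by move=> A hA; apply: (le_bigmax_cond _ (min_bundle v)).
rewrite /mms; elim/big_ind: _ => [|x y [A hA ->] [B hB ->]|A hA].
- by exists grand_allocation => //; apply: grand_allocationP.
- by rewrite /Num.max; case: ifP => _; [exists B | exists A].
- by exists A.
Qed.

End MaximinShare.

(* Main.v *)
Require Import Defs.
From mathcomp Require Import all_boot all_order all_algebra.
From mathcomp Require Import reals.
From mathcomp Require Import zify.
Import Order.TTheory GRing.Theory Num.Theory.
Local Open Scope ring_scope.

(** Put [m = #|M|] and [k = 2n - m]. If [m < n], every partition has an empty
    bundle and any allocation works. Otherwise [0 < k <= n]. Every partition
    has a bundle with at most one good, so by leveledness two goods satisfy
    anybody. Moreover an MMS partition of an agent without empty bundles
    contains at least [k] singletons, so at least [k] goods are each worth the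
    MMS to this agent. Hence the first [k] agents can greedily pick distinct
    goods that satisfy them, and the remaining [m - k = 2(n - k)] goods are
    handed out in pairs to the remaining [n - k] agents. *)

Lemma sum_card_allocation (n : nat) (M : finType) (A : {ffun 'I_n -> {set M}})
    (G : {set M}) :
  A \in allocations n M -> (\sum_i #|A i :&: G| = #|G|)%N.
Proof.
rewrite inE => /andP[/forallP disjA /eqP coverA].
have disj i j : i != j -> [disjoint A i & A j].
  by move=> neq_ij; move/forallP: (disjA i) => /(_ j) /implyP; apply.
have := partition_disjoint_bigcup addn (fun x => if x \in G then 1 else 0)%N disj.
rewrite coverA -big_mkcondr => sumE.
have -> : #|G| = (\sum_(x in [set: M] | x \in G) 1)%N.
  by rewrite -sum1_card; apply: eq_bigl => x; rewrite inE.
rewrite sumE; apply: eq_bigr => i _; rewrite -big_mkcondr -sum1_card.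
by apply: eq_bigl => x; rewrite inE.
Qed.

Lemma small_bundle (n c : nat) (M : finType) (A : {ffun 'I_n -> {set M}}) :
  A \in allocations n M -> (#|M| < n * c)%N -> exists k, (#|A k| < c)%N.
Proof.
move=> allocA; rewrite -cardsT -(sum_card_allocation _ _ _ setT allocA) => ltAnc.
apply/existsP; apply: contraLR ltAnc; rewrite negb_exists -leqNgt => /forallP geAc.
rewrite -[n in (n * c)%N]card_ord -sum_nat_const; apply: leq_sum => i _.
by rewrite setIT leqNgt geAc.
Qed.

Section MaximinShareBounds.
Variables (R : realType) (M : finType) (n : nat) (n_gt0 : (0 < n)%N).
Variable v : {set M} -> R.

(** Pigeonhole in a partition attaining the maximin share, each of whose bundles is worth at least
    that share. *)
Lemma mms_le_some_small_bundle (c : nat) :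
  (#|M| < n * c)%N -> exists2 T : {set M}, (#|T| < c)%N & mms n_gt0 v <= v T.
Proof.
move=> ltMnc; have [[A allocA ->] _] := mmsP n_gt0 v.
have [k ltAc] := small_bundle _ _ _ _ allocA ltMnc.
by exists (A k) => //; have [_] := min_bundleP n_gt0 v A; apply.
Qed.

Lemma mms_le_monotone (S : {set M}) :
  monotone v -> (#|M| < n)%N -> mms n_gt0 v <= v S.
Proof.
move=> mono_v ltMn; have [|T] := mms_le_some_small_bundle 1; first by rewrite muln1.
rewrite ltnS leqn0 cards_eq0 => /eqP -> le_mms.
by apply: le_trans le_mms (mono_v _ _ (sub0set S)).
Qed.

Lemma mms_le_leveled (S : {set M}) :
  leveled v -> (#|M| < n * #|S|)%N -> mms n_gt0 v <= v S.
Proof.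
move=> lev_v /mms_le_some_small_bundle[T ltTS le_mms].
exact: le_trans le_mms (ltW (lev_v _ _ ltTS)).
Qed.

Lemma card_goods_worth_mms :
  monotone v -> (n <= #|M|)%N ->
  (2 * n - #|M| <= #|[set x | (mms n_gt0 v <= v [set x])%R]|)%N.
Proof.
move=> mono_v leqnM; set G := [set x | _].
have [[A allocA mmsE] _] := mmsP n_gt0 v.
have le_mms k : mms n_gt0 v <= v (A k).
  by rewrite mmsE; have [_] := min_bundleP n_gt0 v A; apply.
(* An empty bundle forces the share down to [v set0], so by monotonicity every single good reaches
   it. *)
have [/existsP[k /eqP Ak0] | /existsPn A_neq0] := boolP [exists k, A k == set0].
  have -> : G = setT.
    apply/setP => x; rewrite !inE; apply: le_trans (le_mms k) _.
    by rewrite Ak0; apply: mono_v; apply: sub0set.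
  by rewrite cardsT; lia.
(* It remains to show [2 * n <= #|M| + #|G|]. Summed over bundles, this follows from
   [#|A i| + #|A i :&: G| >= 2]: a nonempty bundle has two goods or is a singleton, whose good lies
   in [G]. *)
rewrite leq_subLR -cardsT -(sum_card_allocation _ _ _ setT allocA).
rewrite -(sum_card_allocation _ _ _ G allocA) -big_split mulnC.
rewrite -[n in (n * 2)%N]card_ord -sum_nat_const; apply: leq_sum => i _ /=.
rewrite setIT; have := A_neq0 i; rewrite -cards_eq0.
have [/eqP/cards1P[x Aix] _|] := eqVneq #|A i| 1%N; last first.
  by case: #|A i| => [|[|c]].
have -> : A i :&: G = A i.
  by apply/setIidPl; rewrite Aix sub1set inE -Aix.
by rewrite Aix cards1.
Qed.

End MaximinShareBounds.

(** When agent [i] chooses, only [i] goods are gone, fewer than [S i] contains. The list [s] records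
    the choices in order, so [index x s = i] says that [x] is the choice of agent [i] and makes the
    choices distinct. *)
Lemma greedy_choice (n k : nat) (M : finType) (S : 'I_n -> {set M}) :
  (k <= n)%N -> (forall i : 'I_n, i < k -> i < #|S i|)%N ->
  exists2 s : seq M, uniq s /\ size s = k &
    forall i : 'I_n, (i < k)%N -> exists2 x, x \in S i & index x s = i.
Proof.
elim: k => [|k IHk] leqkn ltS; first by exists [::].
have [||s [uniq_s size_s] sP] := IHk; [exact: ltnW | by move=> i /ltnW; apply: ltS |].
pose a := Ordinal leqkn.
have /subsetPn[y Say s'y] : ~~ (S a \subset s).
  apply: contraL (ltS a (leqnn _)) => /subset_leq_card leSs.
  by rewrite -leqNgt (leq_trans leSs) // -[X in (_ <= X)%N]size_s card_size.
exists (rcons s y); first by rewrite rcons_uniq s'y size_rcons size_s.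
move=> i; rewrite ltnS leq_eqVlt => /predU1P[ik | ltik].
  exists y; first by rewrite (_ : i = a) //; apply: val_inj.
  by rewrite -cats1 index_cat (negPf s'y) /= eqxx addn0 size_s.
have [x Six xi] := sP i ltik; exists x => //.
by rewrite -cats1 index_cat -index_mem xi size_s ltik.
Qed.

Lemma fibers_allocation (n : nat) (M : finType) (o : M -> 'I_n) :
  [ffun i => [set x | o x == i]] \in allocations n M.
Proof.
rewrite inE; apply/andP; split.
  apply/forallP => i; apply/forallP => j; apply/implyP => neq_ij.
  rewrite !ffunE; apply/pred0P => x /=; rewrite !inE.
  by apply: contraNF neq_ij => /andP[/eqP <- /eqP <-].
rewrite eqEsubset subsetT /=; apply/subsetP => x _.
by apply/bigcupP; exists (o x); rewrite // ffunE inE.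
Qed.

Lemma singletons_and_pairs_allocation (n : nat) (M : finType) (S : 'I_n -> {set M}) :
  (n <= #|M| < 2 * n)%N -> (forall i, 2 * n - #|M| <= #|S i|)%N ->
  exists2 A : {ffun 'I_n -> {set M}}, A \in allocations n M &
    forall i, (exists2 x, x \in S i & x \in A i) \/ (1 < #|A i|)%N.
Proof.
case/andP=> leqnM ltM2n; set k := (2 * n - #|M|)%N => leS.
have [||s [uniq_s size_s] sP] := greedy_choice n k M S; first by lia.
  by move=> i /leq_trans; apply.
(* [t] lists every good once, the greedily chosen ones first; ownership is then defined by position
   in [t]. *)
pose t := s ++ enum [predC s].
have uniq_t : uniq t.
  rewrite cat_uniq uniq_s enum_uniq andbT; apply/hasPn => x.
  by rewrite mem_enum.
have size_t : size t = #|M|.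
  by rewrite size_cat -cardE -(card_uniqP uniq_s) cardC.
(* The first [k] positions go to the agents of the same number; positions [k + 2 * l] and
   [k + 2 * l + 1] go to agent [k + l]. As [#|M| - k = 2 * (n - k)], the owners stay below [n]. *)
pose pos j := if (j < k)%N then j else (k + (j - k)./2)%N.
have pos_lt x : (pos (index x t) < n)%N.
  have : (index x t < size t)%N.
    by rewrite index_mem mem_cat mem_enum inE orbN.
  by rewrite /pos; case: ifP; lia.
exists [ffun i => [set x | Ordinal (pos_lt x) == i]]; first exact: fibers_allocation.
move=> i; rewrite ffunE; have [ltik | leki] := ltnP i k.
  left; have [x Six xi] := sP i ltik; exists x => //.
  by rewrite inE -val_eqE /= /pos index_cat -index_mem xi size_s ltik ltik.
right; have lt0M : (0 < #|M|)%N by have := ltn_ord i; lia.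
have [x0 _] := card_gt0P lt0M.
(* The first of the two consecutive positions owned by agent [i]. *)
pose j := (k + 2 * (i - k))%N.
have ltj : (j.+1 < #|M|)%N by rewrite /j; have := ltn_ord i; lia.
have neq : nth x0 t j != nth x0 t j.+1.
  by rewrite nth_uniq ?size_t //; lia.
have -> : 2%N = #|[set nth x0 t j; nth x0 t j.+1]| by rewrite cards2 neq.
apply: subset_leq_card; apply/subsetP => x; rewrite !inE.
by case/orP => /eqP ->; apply/eqP/val_inj;
  rewrite /= index_uniq ?size_t // /pos /j; case: ltnP; lia.
Qed.

Theorem proposition3p1 (R : realType) (n : nat) (n_gt0 : (0 < n)%N)
    (M : finType) (card_M : (#|M| < 2 * n)%N)
    (v : 'I_n -> {set M} -> R)
    (v_nonnegative : forall i : 'I_n, nonnegative (v i))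
    (v_normalized : forall i : 'I_n, normalized (v i))
    (v_monotone : forall i : 'I_n, monotone (v i))
    (v_leveled : forall i : 'I_n, leveled (v i)) :
  exists2 A : {ffun 'I_n -> {set M}},
    A \in allocations n M & forall i : 'I_n, mms n_gt0 (v i) <= v i (A i).
Proof.
have [ltMn | leqnM] := ltnP #|M| n.
  exists (grand_allocation M n_gt0); first exact: grand_allocationP.
  by move=> i; apply: mms_le_monotone.
pose S i := [set x | mms n_gt0 (v i) <= v i [set x]].
have [||A allocA AP] := singletons_and_pairs_allocation n M S.
- by rewrite leqnM.
- by move=> i; apply: card_goods_worth_mms.
exists A => // i; have [[x Six Aix] | ltA] := AP i.
  move: Six; rewrite inE => /le_trans; apply.
  by apply: v_monotone; rewrite sub1set.
(* With two goods in [A i], [#|M| < 2 * n <= n * #|A i|]. *)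
apply: mms_le_leveled => //; apply: leq_trans card_M _.
by rewrite mulnC leq_mul2l ltA orbT.
Qed.
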